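(* Let $T^*:=\frac1\mu\ln M$. Assume that $T_{2n}=T^0$ for all $n\in\mathbb N$, with $T^0\ge\tau$ and $T^0>T^*$; that $T_{2n+1}=\tilde T$ for all $n\in\mathbb N$, with $\tilde T\le\tau$; and that $$\sup_{n\in\mathbb N}\ e^{B_{2n+1}\tilde T}\left(c+1-e^{-B_{2n+1}\tilde T}\right)=d<1,$$ where $c=Me^{-\mu T^0}$. Then there exist two positive constants $C,\alpha$ such that $$\|U(t)\|\le Ce^{-\alpha t}\|U_0\|,\qquad t>0,$$ for any solution $U$ of the problem $U_t(t)=\mathcal A U(t)+\mathcal B(t)U(t-\tau)$, $t>0$, $U(0)=U_0$ (with $U_0\in\mathcal H$ arbitrary).
   Context: $\mathcal H$ is a Hilbert space with norm $\|\cdot\|$, and $\mathcal L(\mathcal H)$ is the space of bounded linear operators from $\mathcal H$ to itself. $\mathcal A$ is a dissipative (in general unbounded) linear operator in $\mathcal H$ generating a $C_0$-semigroup $(S(t))_{t\ge 0}$, and $M,\mu>0$ are constants with $\|S(t)\|_{\mathcal L(\mathcal H)}\le Me^{-\mu t}$ for all $t\ge 0$. The delay $\tau>0$ is a fixed constant. $\mathbb N=\{0,1,2,\dots\}$. There is a strictly increasing sequence of real numbers $(t_n)_{n\in\mathbb N}$ with $t_0=0$; put $I_n=[t_n,t_{n+1})$ and $T_n=t_{n+1}-t_n$. For each $n\in\mathbb N$, $\mathcal B(t)=0$ for $t\in I_{2n}$ and $\mathcal B(t)=\mathcal B_{2n+1}$ for $t\in I_{2n+1}$, where $\mathcal B_{2n+1}\in\mathcal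 L(\mathcal H)$ is a fixed operator; $B_{2n+1}:=\|\mathcal B_{2n+1}\|_{\mathcal L(\mathcal H)}$. A solution means a mild solution: a function $U\in C([0,\infty);\mathcal H)$ satisfying $U(t)=S(t)U_0+\int_0^t S(t-s)\mathcal B(s)U(s-\tau)\,ds$ for all $t\ge0$. The integrand is taken to be $0$ wherever $\mathcal B(s)=0$; in particular this is so for $s<t_1$, where $t_1\ge\tau$, so no values of $U$ at negative times are needed. *)

(* Defs.v *)
From Stdlib Require Import Reals.
From Coquelicot Require Import Coquelicot.
Open Scope R_scope.

(** The field of scalars is either R or C, since the theorem holds over both. *)
Inductive scalar_field := real_scalars | complex_scalars.

Definition scalars (k : scalar_field) : AbsRing :=
  match k with
  | real_scalars => R_AbsRing
  | complex_scalars => C_AbsRing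
  end.

Definition of_real (k : scalar_field) : R -> scalars k :=
  match k with
  | real_scalars => fun a => a
  | complex_scalars => RtoC
  end.

Definition re (k : scalar_field) : scalars k -> R :=
  match k with
  | real_scalars => fun z => z
  | complex_scalars => fun z => fst z
  end.

Definition conj (k : scalar_field) : scalars k -> scalars k :=
  match k with
  | real_scalars => fun z => z
  | complex_scalars => Cconj
  end.

Lemma of_real_mult (k : scalar_field) (a b : R) :
  of_real k (a * b) = mult (of_real k a) (of_real k b).
Proof. destruct k; [reflexivity | exact (RtoC_mult a b)]. Qed.

Lemma of_real_plus (k : scalar_field) (a b : R) :
  of_real k (a + b) = plus (of_real k a) (of_real k b).
Proof. destruct k; [reflexivity | exact (RtoC_plus a b)]. Qed.

Lemma of_real_one (k : scalar_field) : of_real k 1 = one.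
Proof. destruct k; reflexivity. Qed.

Lemma abs_of_real (k : scalar_field) (a : R) : abs (of_real k a) = Rabs a.
Proof. destruct k; [reflexivity | exact (Cmod_R a)]. Qed.

(** Completeness is part of [CompleteNormedModule].  Definiteness of the inner
    product follows from [inner_norm], as [norm] vanishes only at [zero]. *)
Record HilbertSpace (k : scalar_field) := {
  hilbert_space :> CompleteNormedModule (scalars k);
  inner : hilbert_space -> hilbert_space -> scalars k;
  inner_plus : forall x y z, inner (plus x y) z = plus (inner x z) (inner y z);
  inner_scal : forall a x z, inner (scal a x) z = mult a (inner x z);
  inner_conj : forall x y, inner y x = conj k (inner x y);
  inner_norm : forall x, inner x x = of_real k (norm x ^ 2)
}.
Arguments inner {k h} _ _.

(** Restriction of scalars: Coquelicot's Riemann integral [is_RInt] is only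
    defined for functions with values in a normed module over R.  The carrier,
    addition, norm and topology are unchanged. *)
Section Realify.
Context (k : scalar_field) (V : CompleteNormedModule (scalars k)).

Definition real_scal (a : R_Ring) (x : V) : V := scal (of_real k a) x.

Lemma real_scal_assoc (a b : R_Ring) (x : V) :
  real_scal a (real_scal b x) = real_scal (mult a b) x.
Proof.
  unfold real_scal. rewrite scal_assoc. f_equal. symmetry. apply of_real_mult.
Qed.

Lemma real_scal_one (x : V) : real_scal one x = x.
Proof.
  unfold real_scal. transitivity (scal one x); [f_equal; apply of_real_one|].
  apply scal_one.
Qed.

Lemma real_scal_distr_l (a : R_Ring) (x y : V) :
  real_scal a (plus x y) = plus (real_scal a x) (real_scal a y).
Proof. unfold real_scal. apply (scal_distr_l (V := V)). Qed.

Lemma real_scal_distr_r (a b : R_Ring) (x : V) :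
  real_scal (plus a b) x = plus (real_scal a x) (real_scal b x).
Proof.
  unfold real_scal. rewrite <- (scal_distr_r (V := V)). f_equal. apply of_real_plus.
Qed.

Definition realify_ModuleSpace : ModuleSpace R_Ring :=
  ModuleSpace.Pack R_Ring V
    (ModuleSpace.Class R_Ring V _
       (ModuleSpace.Mixin R_Ring V real_scal real_scal_assoc real_scal_one
          real_scal_distr_l real_scal_distr_r)) V.

Definition realify_NormedModuleAux : NormedModuleAux R_AbsRing :=
  NormedModuleAux.Pack R_AbsRing V
    (NormedModuleAux.Class R_AbsRing V
       (ModuleSpace.class R_Ring realify_ModuleSpace) (UniformSpace.class V)) V.

Lemma norm_real_scal (a : R_AbsRing) (x : V) :
  norm (real_scal a x) <= abs a * norm x.
Proof.
  unfold real_scal. change (abs a) with (Rabs a).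
  rewrite <- (abs_of_real k). exact (norm_scal (V := V) (of_real k a) x).
Qed.

Definition realify_NormedModule_mixin :
  NormedModule.mixin_of R_AbsRing realify_NormedModuleAux :=
  NormedModule.Mixin R_AbsRing realify_NormedModuleAux
    (@norm (scalars k) V) (@norm_factor (scalars k) V)
    (@norm_triangle (scalars k) V) norm_real_scal
    (@norm_compat1 (scalars k) V) (@norm_compat2 (scalars k) V)
    (@norm_eq_zero (scalars k) V).

Definition realify : CompleteNormedModule R_AbsRing :=
  CompleteNormedModule.Pack R_AbsRing V
    (CompleteNormedModule.Class R_AbsRing V
       (NormedModule.Class R_AbsRing V
          (NormedModuleAux.class R_AbsRing realify_NormedModuleAux)
          realify_NormedModule_mixin)
       (CompleteNormedModule.mixin _ _ (CompleteNormedModule.class _ V))) V.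

End Realify.
Arguments realify {k} V.

(** [is_linear] includes boundedness. *)
Record bounded_operator {k : scalar_field} (H : HilbertSpace k) := {
  bounded_operator_fun :> H -> H;
  bounded_operator_linear : is_linear bounded_operator_fun
}.

(** For a bounded operator, the set is nonempty and bounded, so its least upper
    bound is finite. *)
Definition op_norm {k : scalar_field} {H : HilbertSpace k}
  (T : bounded_operator H) : R :=
  real (Lub_Rbar (fun r => exists x : H, norm x <= 1 /\ r = norm (T x))).

(** A linear operator with domain; values of [operator_fun] outside the domain
    are irrelevant. *)
Record linear_operator {k : scalar_field} (H : HilbertSpace k) := {
  domain : H -> Prop;
  operator_fun :> H -> H;
  domain_zero : domain zero;
  domain_plus : forall x y, domain x -> domain y -> domain (plus x y);
  domain_scal : forall a x, domain x -> domain (scal a x);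
  operator_plus : forall x y, domain x -> domain y ->
    operator_fun (plus x y) = plus (operator_fun x) (operator_fun y);
  operator_scal : forall a x, domain x ->
    operator_fun (scal a x) = scal a (operator_fun x)
}.
Arguments domain {k H} _ _.

Definition dissipative {k : scalar_field} {H : HilbertSpace k}
  (A : linear_operator H) : Prop :=
  forall x : H, domain A x -> re k (inner (A x) x) <= 0.

(** Only the values [S t] with [0 <= t] matter. *)
Definition C0_semigroup {k : scalar_field} {H : HilbertSpace k}
  (S : R -> bounded_operator H) : Prop :=
  (forall x : H, S 0 x = x) /\
  (forall (s t : R) (x : H), 0 <= s -> 0 <= t -> S (s + t) x = S s (S t x)) /\
  (forall x : H, filterlim (fun t => S t x) (at_right 0) (locally x)).

Definition generates {k : scalar_field} {H : HilbertSpace k}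
  (A : linear_operator H) (S : R -> bounded_operator H) : Prop :=
  forall x y : H,
    (domain A x /\ A x = y) <->
    filterlim (fun h => scal (of_real k (/ h)) (minus (S h x) x))
      (at_right 0) (locally y).

Definition continuous_on_nonneg {k : scalar_field} {H : HilbertSpace k}
  (U : R -> H) : Prop :=
  forall t : R, 0 <= t ->
    filterlim U (within (fun s => 0 <= s) (locally t)) (locally (U t)).

(** The values of [U] at negative times are arbitrary: they only enter through
    [B s (U (s - tau))] with [s < tau], where [B s] is assumed to vanish.
    The Riemann integral suffices, as for piecewise constant [B] the integrand
    is piecewise continuous. *)
Definition mild_solution {k : scalar_field} {H : HilbertSpace k}
  (S : R -> bounded_operator H) (B : R -> bounded_operator H) (tau : R)
  (U0 : H) (U : R -> H) : Prop :=
  continuous_on_nonneg U /\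
  forall t : R, 0 <= t ->
    exists I : H,
      is_RInt (V := realify H) (fun s => S (t - s) (B s (U (s - tau)))) 0 t I /\
      U t = plus (S t U0) I.

(* Main.v *)
Require Import Defs.
From Stdlib Require Import Reals Lra Lia ssreflect.
From Coquelicot Require Import Coquelicot.
Open Scope R_scope.

(** The norms at the times [t (2 * n)], where a delay-free interval begins,
    decrease geometrically, with ratio at most [d].

    Two bounds on the semigroup are combined.  Besides the exponential bound, the
    semigroup is a contraction because its generator is dissipative
    ([dissipative_contraction]).  Write [a], [m], [e] for three consecutive times
    [t (2 * n)], [t (2 * n + 1)], [t (2 * n + 2)], and [b] for the norm of the
    feedback operator that acts on [[m, e]].  On [[a, m]] the solution is
    [S (s - a) (U a)], so its norm stays below that of [U a], and
    [norm (U m) <= c * norm (U a)] with [c = M * exp (- mu * T0)].  On [[m, e]] the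
    delayed argument [s - tau] lies in [[a, m]], since [e - m <= tau <= m - a].
    Hence the forcing term is at most [b * norm (U a)] there, and the variation of
    constants formula restarted at [m] gives
    [norm (U s) <= (c + b * Ttilde) * norm (U a)]: this is [period_estimate].

    For [x = b * Ttilde >= 0] the inequality
    [c + x <= exp x * (c + 1 - exp (- x))] bounds the factor by [d < 1]
    ([affine_le_exp]).  As all periods have the same length [T0 + Ttilde], a
    geometric decay over periods is an exponential decay in time
    ([exponential_of_geometric]), with [C = / d] and
    [alpha = - ln d / (T0 + Ttilde)].

    The contraction property needs an argument, as dissipativity only concerns the
    domain of the generator.  There, [norm (S t x) ^ 2] grows over a step [h] by at
    most [eps * h], uniformly in [t] ([energy_step]), so it does not grow at all.
    The means of an orbit over short intervals belong to the domain and approximate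
    its initial point, which extends the bound to all vectors.

    These parts are stated for real normed spaces; a Hilbert space over either
    field of scalars is one after restriction of scalars. *)

(** * Linear algebra and integrals in real normed spaces *)

Lemma minus_exchange {G : AbelianGroup} (a b c d : G) :
  plus a b = plus c d -> minus b c = minus d a.
Proof.
  intros H. rewrite /minus.
  replace b with (plus (opp a) (plus c d))
    by (rewrite -H plus_assoc plus_opp_l; apply plus_zero_l).
  rewrite (plus_comm c) plus_assoc -(plus_assoc _ c) plus_opp_r plus_zero_r.
  apply plus_comm.
Qed.

Lemma minus_minus_swap {G : AbelianGroup} (a b c d : G) :
  minus (minus a b) (minus c d) = minus (minus a c) (minus b d).
Proof.
  rewrite /minus !opp_plus !opp_opp -!plus_assoc. f_equal.
  rewrite !plus_assoc. f_equal. apply plus_comm.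
Qed.

Section NormedModuleFacts.
Context {V : NormedModule R_AbsRing}.

Lemma plus_minus_r (x y : V) : plus x (minus y x) = y.
Proof.
  rewrite /minus (plus_comm y) plus_assoc plus_opp_r. apply plus_zero_l.
Qed.

Lemma scal_inv_l (a : R) (x : V) : a <> 0 -> scal (/ a) (scal a x) = x.
Proof.
  intros Ha. rewrite scal_assoc.
  replace (mult (/ a) a) with (one : R_AbsRing) by (symmetry; apply Rinv_l, Ha).
  apply scal_one.
Qed.

Lemma scal_inv_r (a : R) (x : V) : a <> 0 -> scal a (scal (/ a) x) = x.
Proof.
  intros Ha. rewrite scal_assoc.
  replace (mult a (/ a)) with (one : R_AbsRing) by (symmetry; apply Rinv_r, Ha).
  apply scal_one.
Qed.

Lemma norm_scal_pos (a : R) (x : V) : 0 < a -> norm (scal a x) = a * norm x.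
Proof.
  intros Ha.
  assert (Hle : forall (b : R) (z : V), 0 < b -> norm (scal b z) <= b * norm z).
  { intros b z Hb. assert (H := norm_scal (K := R_AbsRing) b z).
    change (abs b) with (Rabs b) in H. now rewrite (Rabs_pos_eq b (Rlt_le _ _ Hb)) in H. }
  apply Rle_antisym; [now apply Hle|].
  rewrite -{1}(scal_inv_l a x); try lra.
  apply Rle_trans with (a * (/ a * norm (scal a x))).
  - apply Rmult_le_compat_l; [lra|]. apply Hle. now apply Rinv_0_lt_compat.
  - right. field. lra.
Qed.

Lemma norm_minus_sym (x y : V) : norm (minus x y) = norm (minus y x).
Proof. by rewrite -(norm_opp (minus x y)) opp_minus. Qed.

Lemma norm_le_minus (x y : V) : norm x <= norm y + norm (minus x y).
Proof. rewrite -{1}(plus_minus_r y x). apply norm_triangle. Qed.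

Lemma filterlim_at_right_norm (f : R -> V) (l : V) :
  filterlim f (at_right 0) (locally l) <->
  forall eps, 0 < eps -> exists delta, 0 < delta /\
    forall h, 0 < h < delta -> norm (minus (f h) l) < eps.
Proof.
  split.
  - intros Hf eps Heps.
    destruct (proj1 (filterlim_locally_ball_norm f l) Hf (mkposreal eps Heps))
      as [delta Hdelta].
    exists delta. split; [apply cond_pos|]. intros h Hh. apply Hdelta; [|lra].
    change (Rabs (h - 0) < delta). rewrite Rabs_pos_eq; lra.
  - intros Hf. apply filterlim_locally_ball_norm. intros eps.
    destruct (Hf eps (cond_pos eps)) as [delta [Hd Hdelta]].
    exists (mkposreal delta Hd). intros h Hh Hpos. apply Hdelta.
    change (Rabs (h - 0) < delta) in Hh. rewrite Rabs_pos_eq in Hh; lra.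
Qed.

End NormedModuleFacts.

Lemma linear_minus {U V : NormedModule R_AbsRing} (T : U -> V) (x y : U) :
  is_linear T -> T (minus x y) = minus (T x) (T y).
Proof.
  intros HT. rewrite /minus (linear_plus T HT). f_equal.
  rewrite -(scal_opp_one y) -(scal_opp_one (T y)). exact (linear_scal T HT _ _).
Qed.

Lemma linear_zero {K : AbsRing} {U V : NormedModule K} (T : U -> V) :
  is_linear T -> T zero = zero.
Proof.
  intros HT. rewrite -{1}(scal_zero_l (zero : U)) (linear_scal T HT).
  exact (scal_zero_l (T zero)).
Qed.

Lemma linear_Riemann_sum {U V : NormedModule R_AbsRing} (T : U -> V) (f : R -> U)
  (p : SF_seq) :
  is_linear T -> T (Riemann_sum f p) = Riemann_sum (fun s => T (f s)) p.
Proof.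
  intros HT. revert p. apply: SF_cons_ind => [x0|h s IH].
  - exact (linear_zero T HT).
  - rewrite !Riemann_sum_cons (linear_plus T HT) IH. f_equal.
    exact (linear_scal T HT _ _).
Qed.

Lemma is_RInt_linear {U V : NormedModule R_AbsRing} (T : U -> V) (f : R -> U)
  (a b : R) (l : U) :
  is_linear T -> is_RInt f a b l -> is_RInt (fun s => T (f s)) a b (T l).
Proof.
  intros HT Hf. unfold is_RInt in *.
  apply filterlim_ext with
    (fun ptd => T (scal (sign (b - a)) (Riemann_sum f ptd))).
  - intros ptd. rewrite -(linear_Riemann_sum T f ptd HT). apply (linear_scal T HT).
  - eapply filterlim_comp; [exact Hf|]. apply linear_cont, HT.
Qed.

Lemma is_RInt_shift {V : NormedModule R_AbsRing} (f : R -> V) (a b r : R) (l : V) :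
  is_RInt f (a + r) (b + r) l -> is_RInt (fun s => f (s + r)) a b l.
Proof.
  intros Hf.
  assert (H := is_RInt_comp_lin f 1 r a b l).
  rewrite !Rmult_1_l in H. specialize (H Hf).
  revert H. apply is_RInt_ext. intros s _.
  rewrite Rmult_1_l. exact (scal_one (f (s + r))).
Qed.

Lemma is_RInt_inj {W : CompleteNormedModule R_AbsRing} (f : R -> W) (a b : R) (l1 l2 : W) :
  is_RInt f a b l1 -> is_RInt f a b l2 -> l1 = l2.
Proof. intros H1 H2. rewrite -(is_RInt_unique _ _ _ _ H1). now apply is_RInt_unique. Qed.

(** * Dissipative generators and contraction semigroups *)

Record bounded_semigroup {V : NormedModule R_AbsRing} (S : R -> V -> V) (M : R) : Prop := {
  semigroup_linear : forall t, is_linear (S t);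
  semigroup_zero : forall x, S 0 x = x;
  semigroup_add : forall s t x, 0 <= s -> 0 <= t -> S (s + t) x = S s (S t x);
  semigroup_cont : forall x, filterlim (fun t => S t x) (at_right 0) (locally x);
  semigroup_bound_pos : 0 < M;
  semigroup_bound : forall t x, 0 <= t -> norm (S t x) <= M * norm x
}.

(** The graph of the generator: the derivative of the orbit of [x] at 0 is [y]. *)
Definition generator {V : NormedModule R_AbsRing} (S : R -> V -> V) (x y : V) : Prop :=
  filterlim (fun h => scal (/ h) (minus (S h x) x)) (at_right 0) (locally y).

Record real_inner_product {V : NormedModule R_AbsRing} (ip : V -> V -> R) : Prop := {
  ip_plus : forall x y z, ip (plus x y) z = ip x z + ip y z;
  ip_scal : forall a x z, ip (scal a x) z = a * ip x z;
  ip_sym : forall x y, ip x y = ip y x;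
  ip_norm : forall x, ip x x = norm x ^ 2
}.

Lemma norm_plus_sqr {V : NormedModule R_AbsRing} (ip : V -> V -> R) (x y : V) :
  real_inner_product ip ->
  norm (plus x y) ^ 2 = norm x ^ 2 + 2 * ip y x + norm y ^ 2.
Proof.
  intros Hip. rewrite -!(ip_norm ip Hip) !(ip_plus ip Hip).
  rewrite (ip_sym ip Hip x (plus x y)) (ip_sym ip Hip y (plus x y))
    !(ip_plus ip Hip) (ip_sym ip Hip x y). ring.
Qed.

(** This half of the Cauchy-Schwarz inequality is the triangle inequality for
    [plus x y], squared. *)
Lemma ip_le_norm {V : NormedModule R_AbsRing} (ip : V -> V -> R) (x y : V) :
  real_inner_product ip -> ip y x <= norm y * norm x.
Proof.
  intros Hip. assert (H := norm_plus_sqr ip x y Hip).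
  assert (Ht := norm_triangle x y). assert (H0 := norm_ge_0 (plus x y)).
  assert (norm (plus x y) ^ 2 <= (norm x + norm y) ^ 2) by (apply pow_incr; lra).
  lra.
Qed.

Section EnergyDecay.
Context {V : NormedModule R_AbsRing} (S : R -> V -> V) (M : R)
  (HS : bounded_semigroup S M).

(** [S t] commutes with the difference quotients at 0 and is continuous. *)
Lemma generator_semigroup (t : R) (x y : V) :
  0 <= t -> generator S x y -> generator S (S t x) (S t y).
Proof.
  intros Ht Hx. unfold generator in *.
  apply filterlim_within_ext with
    (fun h => S t (scal (/ h) (minus (S h x) x))).
  - intros h Hh. rewrite (linear_scal _ (semigroup_linear S M HS t))
      (linear_minus _ _ _ (semigroup_linear S M HS t)).
    rewrite -!(semigroup_add S M HS); try lra. by rewrite Rplus_comm.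
  - eapply filterlim_comp; [exact Hx|].
    apply linear_cont, (semigroup_linear S M HS).
Qed.

(** With [z = S t x] and [q] the difference quotient of the orbit of [x] over the
    step [h], the new point is [z + h * S t q].  Expanding its squared norm, the
    first order term is nonpositive by dissipativity, up to the error [q - y], to
    which only the bounded operator [S t] is applied; so the choice of [delta] does not depend on
    [t]. *)
Lemma energy_step (ip : V -> V -> R) (x y : V) :
  real_inner_product ip ->
  (forall x y, generator S x y -> ip y x <= 0) ->
  generator S x y ->
  forall eps, 0 < eps -> exists delta, 0 < delta /\
    forall t h, 0 <= t -> 0 < h < delta ->
      norm (S (t + h) x) ^ 2 <= norm (S t x) ^ 2 + eps * h.
Proof.
  intros Hip Hdiss Hxy eps Heps.
  assert (HM := semigroup_bound_pos S M HS).
  assert (Hnx := norm_ge_0 x). assert (Hny := norm_ge_0 y).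
  (* An error [q - y] of norm [e] changes the first order term by at most
     [h * eps / 2]; the other half of [eps] is for the quadratic term. *)
  set (e := Rmin 1 (eps / (4 * M ^ 2 * (norm x + 1)))).
  assert (Hden : 0 < 4 * M ^ 2 * (norm x + 1)).
  { assert (0 < M ^ 2) by (apply pow_lt; lra).
    repeat apply Rmult_lt_0_compat; lra. }
  assert (He : 0 < e).
  { apply Rmin_glb_lt; [lra|]. now apply Rdiv_lt_0_compat. }
  assert (He1 : e <= 1) by apply Rmin_l.
  assert (He2 : 2 * M ^ 2 * norm x * e <= eps / 2).
  { apply Rle_trans with (2 * M ^ 2 * (norm x + 1) * (eps / (4 * M ^ 2 * (norm x + 1)))).
    - apply Rmult_le_compat; try lra.
      + apply Rmult_le_pos; [|lra]. apply Rmult_le_pos; [lra|]. apply pow_le; lra.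
      + apply Rmult_le_compat_l; [|lra].
        apply Rmult_le_pos; [lra|]. apply pow_le; lra.
      + apply Rmin_r.
    - right. field. split; lra. }
  destruct (proj1 (filterlim_at_right_norm _ _) Hxy e He) as [delta [Hd Hdelta]].
  set (K := M ^ 2 * (norm y + 1) ^ 2).
  assert (HK : 0 < K).
  { apply Rmult_lt_0_compat; apply pow_lt; lra. }
  exists (Rmin delta (eps / (2 * K))). split.
  { apply Rmin_glb_lt; [lra|]. apply Rdiv_lt_0_compat; lra. }
  intros t h Ht [Hh Hh'].
  assert (Hhd : h < delta) by (eapply Rlt_le_trans; [exact Hh'|apply Rmin_l]).
  assert (HhK : h * K <= eps / 2).
  { apply Rle_trans with (eps / (2 * K) * K).
    - apply Rmult_le_compat_r; [lra|]. left.
      eapply Rlt_le_trans; [exact Hh'|apply Rmin_r].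
    - right. field. lra. }
  set (q := scal (/ h) (minus (S h x) x) : V).
  specialize (Hdelta h (Logic.conj Hh Hhd)).
  change (norm (minus q y) < e) in Hdelta.
  set (z := S t x). set (w := S t q).
  assert (HSt := semigroup_linear S M HS t).
  assert (Hstep : S (t + h) x = plus z (scal h w)).
  { unfold z, w. rewrite -(linear_scal _ HSt) -(linear_plus _ HSt).
    rewrite /q scal_inv_r; try lra. rewrite plus_minus_r.
    apply (semigroup_add S M HS); lra. }
  assert (Hz : norm z <= M * norm x) by now apply (semigroup_bound S M HS).
  assert (Hr : norm (S t (minus q y)) <= M * e).
  { eapply Rle_trans; [now apply (semigroup_bound S M HS)|].
    apply Rmult_le_compat_l; lra. }
  assert (Hw : norm w <= M * (norm y + 1)).
  { eapply Rle_trans; [now apply (semigroup_bound S M HS)|].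
    apply Rmult_le_compat_l; [lra|]. assert (Hq := norm_le_minus q y). lra. }
  (* The part of [w] in the direction of the generator is dissipated; the
     remainder is small uniformly in [t]. *)
  assert (Hwz : ip w z <= M ^ 2 * norm x * e).
  { replace w with (plus (S t y) (S t (minus q y)))
      by (rewrite -(linear_plus _ HSt) plus_minus_r; reflexivity).
    rewrite (ip_plus ip Hip).
    assert (H1 := Hdiss _ _ (generator_semigroup t x y Ht Hxy)). fold z in H1.
    assert (H2 := ip_le_norm ip z (S t (minus q y)) Hip).
    assert (H3 : norm (S t (minus q y)) * norm z <= (M * e) * (M * norm x)).
    { apply Rmult_le_compat; auto using norm_ge_0. }
    lra. }
  rewrite Hstep (norm_plus_sqr ip _ _ Hip) (ip_scal ip Hip)
    (norm_scal_pos _ _ Hh).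
  assert (Hw2 : norm w ^ 2 <= K).
  { rewrite /K -Rpow_mult_distr. apply pow_incr.
    split; [apply norm_ge_0|exact Hw]. }
  rewrite Rpow_mult_distr.
  assert (h * ip w z <= h * (M ^ 2 * norm x * e))
    by (apply Rmult_le_compat_l; lra).
  assert (h * (2 * M ^ 2 * norm x * e) <= h * (eps / 2))
    by (apply Rmult_le_compat_l; lra).
  assert (h * (h * norm w ^ 2) <= h * (h * K)).
  { do 2 (apply Rmult_le_compat_l; [lra|]). exact Hw2. }
  assert (h * (h * K) <= h * (eps / 2)) by (apply Rmult_le_compat_l; lra).
  simpl in *. lra.
Qed.

End EnergyDecay.

(** Over [N] equal steps the increments add up to at most [eps * t], whatever [N];
    as [delta] does not depend on [t], all steps can be taken of the same length. *)
Lemma le_start_of_small_steps (f : R -> R) :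
  (forall eps, 0 < eps -> exists delta, 0 < delta /\
    forall t h, 0 <= t -> 0 < h < delta -> f (t + h) <= f t + eps * h) ->
  forall t, 0 <= t -> f t <= f 0.
Proof.
  intros Hf t Ht.
  destruct Ht as [Ht | <-]; [|lra].
  apply le_epsilon. intros eps Heps.
  (* With rate [eps / t] the total increment over [[0, t]] is [eps]. *)
  destruct (Hf (eps / t)) as [delta [Hd Hstep]];
    [now apply Rdiv_lt_0_compat|].
  destruct (nfloor_ex (t / delta)) as [m Hm].
  { apply Rlt_le, Rdiv_lt_0_compat; lra. }
  set (N := INR m + 1). assert (HN : 0 < N) by (assert (H := pos_INR m); unfold N; lra).
  assert (Hh : 0 < t / N < delta).
  { split; [now apply Rdiv_lt_0_compat|].
    apply Rmult_lt_reg_r with (N / delta); [now apply Rdiv_lt_0_compat|].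
    replace (t / N * (N / delta)) with (t / delta) by (field; lra).
    replace (delta * (N / delta)) with N by (field; lra). exact (proj2 Hm). }
  assert (Hk : forall k : nat,
    f (INR k * (t / N)) <= f 0 + eps / t * (INR k * (t / N))).
  { induction k as [|k IH].
    - simpl INR. rewrite Rmult_0_l. lra.
    - rewrite S_INR.
      replace ((INR k + 1) * (t / N)) with (INR k * (t / N) + t / N) by ring.
      assert (H0 : 0 <= INR k * (t / N)) by (apply Rmult_le_pos; [apply pos_INR|lra]).
      specialize (Hstep _ _ H0 Hh). lra. }
  specialize (Hk (Datatypes.S m)). rewrite S_INR in Hk. fold N in Hk.
  replace (N * (t / N)) with t in Hk by (field; lra).
  replace (eps / t * t) with eps in Hk by (field; lra). exact Hk.
Qed.

Section MeanValues.
(* Completeness serves the existence of integrals.  All vectors are typed in the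
   underlying normed module, so that every operation on them is inherited along
   the same path. *)
Context {W : CompleteNormedModule R_AbsRing}.
Local Notation V := (CompleteNormedModule.NormedModule R_AbsRing W).
Context (S : R -> V -> V) (M : R)
  (HS : bounded_semigroup S M).

(** Factoring out the operator at the smaller time reduces continuity at all times,
    also from the left, to right continuity at 0. *)
Lemma orbit_modulus (a b : R) (x : V) :
  0 <= a -> 0 <= b ->
  norm (minus (S a x) (S b x)) <= M * norm (minus (S (Rabs (a - b)) x) x).
Proof.
  assert (Hwlog : forall a b, 0 <= b <= a ->
    norm (minus (S a x) (S b x)) <= M * norm (minus (S (a - b) x) x)).
  { clear a b. intros a b [Hb Hab].
    replace (S a x) with (S b (S (a - b) x)).
    - rewrite -(linear_minus _ _ _ (semigroup_linear S M HS b)).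
      now apply (semigroup_bound S M HS).
    - rewrite -(semigroup_add S M HS); try lra. f_equal. lra. }
  intros Ha Hb. destruct (Rle_dec b a) as [Hab|Hab].
  - rewrite Rabs_pos_eq; [|lra]. apply Hwlog. lra.
  - rewrite norm_minus_sym Rabs_minus_sym Rabs_pos_eq; [|lra]. apply Hwlog. lra.
Qed.

Lemma semigroup_near_zero (x : V) (eps : R) :
  0 < eps -> exists delta, 0 < delta /\
    forall h, 0 <= h < delta -> M * norm (minus (S h x) x) <= eps.
Proof.
  intros Heps. assert (HM := semigroup_bound_pos S M HS).
  destruct (proj1 (filterlim_at_right_norm _ _) (semigroup_cont S M HS x) (eps / M))
    as [delta [Hd Hdelta]]; [now apply Rdiv_lt_0_compat|].
  exists delta. split; [exact Hd|]. intros h [[Hh|<-] Hh'].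
  - specialize (Hdelta h (Logic.conj Hh Hh')).
    replace eps with (M * (eps / M)) by (field; lra).
    apply Rmult_le_compat_l; lra.
  - rewrite (semigroup_zero S M HS) /minus plus_opp_r norm_zero. lra.
Qed.

(** Extending an orbit evenly to negative times makes it continuous on the whole
    line. *)
Definition orbit (x : V) (s : R) : V := S (Rabs s) x.

Lemma orbit_nonneg (x : V) (s : R) : 0 <= s -> orbit x s = S s x.
Proof. intros Hs. unfold orbit. now rewrite Rabs_pos_eq. Qed.

Lemma continuous_orbit (x : V) (s : R) : continuous (orbit x) s.
Proof.
  apply filterlim_locally_ball_norm. intros eps.
  destruct (semigroup_near_zero x (eps / 2)) as [delta [Hd Hdelta]].
  { assert (H := cond_pos eps). lra. }
  exists (mkposreal delta Hd). intros r Hr. change (Rabs (r - s) < delta) in Hr.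
  unfold ball_norm, orbit. eapply Rle_lt_trans.
  - apply orbit_modulus; apply Rabs_pos.
  - eapply Rle_lt_trans; [apply Hdelta|assert (H := cond_pos eps); lra].
    split; [apply Rabs_pos|].
    eapply Rle_lt_trans; [apply Rabs_triang_inv2|exact Hr].
Qed.

Definition orbit_integral (x : V) (a b : R) : V := RInt (V := W) (orbit x) a b.

Lemma is_RInt_orbit (x : V) (a b : R) :
  is_RInt (orbit x) a b (orbit_integral x a b).
Proof.
  apply (RInt_correct (V := W)), (ex_RInt_continuous (V := W)).
  intros s _. apply continuous_orbit.
Qed.

(** The modulus of continuity of an orbit at [a] is controlled by the one at 0, so
    its mean over [[a, a + r]] approaches the value at [a] uniformly in [a]. *)
Lemma RInt_orbit_error (x : V) (eps : R) :
  0 < eps -> exists delta, 0 < delta /\ forall a r, 0 <= a -> 0 < r < delta ->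
    norm (minus (scal (/ r) (orbit_integral x a (a + r))) (S a x)) <= eps.
Proof.
  intros Heps. destruct (semigroup_near_zero x eps Heps) as [delta [Hd Hdelta]].
  exists delta. split; [exact Hd|]. intros a r Ha [Hr Hr'].
  assert (HI := is_RInt_minus _ _ _ _ _ _ (is_RInt_orbit x a (a + r))
    (is_RInt_const a (a + r) (S a x))).
  apply norm_RInt_le_const with (M := eps) in HI; [|lra|].
  - replace (a + r - a) with r in HI by ring.
    replace (S a x) with (scal (/ r) (scal r (S a x))) by (apply scal_inv_l; lra).
    rewrite -(scal_minus_distr_l (/ r : R_Ring)).
    rewrite (norm_scal_pos (/ r)); [|now apply Rinv_0_lt_compat].
    apply Rmult_le_reg_l with r; [lra|].
    rewrite -Rmult_assoc Rinv_r ?Rmult_1_l; try lra. exact HI.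
  - intros s Hs. rewrite orbit_nonneg; [|lra].
    eapply Rle_trans; [apply orbit_modulus; lra|].
    apply Hdelta. rewrite Rabs_pos_eq; lra.
Qed.

(** [S r] shifts the orbit, hence [S r G - G], for [G] the integral over [[0, h]], is
    the integral over [[h, h + r]] minus the one over [[0, r]]; divided by [r], these
    tend to the values of the orbit at [h] and 0. *)
Lemma generator_RInt_orbit (x : V) (h : R) :
  0 <= h -> generator S (orbit_integral x 0 h) (minus (S h x) x).
Proof.
  intros Hh. apply filterlim_at_right_norm. intros eps Heps.
  destruct (RInt_orbit_error x (eps / 3)) as [delta [Hd Hdelta]]; [lra|].
  exists delta. split; [exact Hd|]. intros r [Hr Hr'].
  set (G := orbit_integral x).
  assert (Hshift : S r (G 0 h) = G r (h + r)).
  { assert (H1 := is_RInt_linear _ _ _ _ _ (semigroup_linear S M HS r)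
      (is_RInt_orbit x 0 h)).
    assert (H2 : is_RInt (fun s => orbit x (s + r)) 0 h (G r (h + r))).
    { apply is_RInt_shift. rewrite Rplus_0_l. apply is_RInt_orbit. }
    refine (is_RInt_inj (W := W) _ _ _ _ _ _ H2). revert H1.
    apply is_RInt_ext. intros s Hs. rewrite Rmin_left in Hs; [|lra].
    rewrite !orbit_nonneg; try lra.
    rewrite Rplus_comm. symmetry. apply (semigroup_add S M HS); lra. }
  assert (Hexch : minus (G r (h + r)) (G 0 h) = minus (G h (h + r)) (G 0 (0 + r))).
  { apply (minus_exchange (G := V)). rewrite Rplus_0_l.
    apply (is_RInt_inj (W := W) (orbit x) 0 (h + r));
      eapply is_RInt_Chasles; apply is_RInt_orbit. }
  rewrite Hshift Hexch scal_minus_distr_l minus_minus_swap.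
  eapply Rle_lt_trans; [apply norm_triangle|]. rewrite norm_opp.
  assert (E1 := Hdelta h r Hh (Logic.conj Hr Hr')).
  assert (E2 := Hdelta 0 r (Rle_refl 0) (Logic.conj Hr Hr')).
  rewrite (semigroup_zero S M HS) in E2.
  eapply Rle_lt_trans; [exact (Rplus_le_compat _ _ _ _ E1 E2)|lra].
Qed.

(** On the domain of the generator this follows from [energy_step].  The domain is
    dense, since it contains the means of the orbit of [x] over [[0, h]], which
    tend to [x]; boundedness of [S t] allows passing to the limit. *)
Lemma dissipative_contraction (ip : V -> V -> R) :
  real_inner_product ip ->
  (forall x y, generator S x y -> ip y x <= 0) ->
  forall t x, 0 <= t -> norm (S t x) <= norm x.
Proof.
  intros Hip Hdiss t x Ht.
  assert (HM := semigroup_bound_pos S M HS).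
  assert (Hdom : forall v w, generator S v w -> norm (S t v) <= norm v).
  { intros v w Hvw.
    assert (Hsq : norm (S t v) ^ 2 <= norm (S 0 v) ^ 2).
    { apply (le_start_of_small_steps (fun r => norm (S r v) ^ 2)); [|exact Ht].
      exact (energy_step S M HS ip v w Hip Hdiss Hvw). }
    rewrite (semigroup_zero S M HS) in Hsq.
    apply Rsqr_incr_0; try apply norm_ge_0.
    rewrite !Rsqr_pow2. exact Hsq. }
  apply le_epsilon. intros eps Heps.
  destruct (RInt_orbit_error x (eps / (1 + M))) as [delta [Hd Hdelta]].
  { apply Rdiv_lt_0_compat; lra. }
  set (h := delta / 2). assert (Hh : 0 < h < delta) by (unfold h; lra).
  specialize (Hdelta 0 h (Rle_refl 0) Hh).
  rewrite (semigroup_zero S M HS) Rplus_0_l in Hdelta.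
  assert (Hgen := generator_RInt_orbit x h (Rlt_le _ _ (proj1 Hh))).
  apply Hdom in Hgen. set (G := orbit_integral x 0 h) in *.
  set (m := scal (/ h) G : V).
  change (norm (minus m x) <= eps / (1 + M)) in Hdelta.
  assert (Hm : norm (S t m) <= norm m).
  { unfold m. rewrite (linear_scal _ (semigroup_linear S M HS t)).
    assert (0 < / h) by (apply Rinv_0_lt_compat; lra).
    rewrite !(norm_scal_pos (/ h)); try lra.
    apply Rmult_le_compat_l; lra. }
  assert (H1 := norm_le_minus (S t x) (S t m)).
  rewrite -(linear_minus _ _ _ (semigroup_linear S M HS t)) in H1.
  assert (H2 := semigroup_bound S M HS t (minus x m) Ht).
  rewrite norm_minus_sym in H2.
  assert (H3 := norm_le_minus m x).
  assert (H4 : M * norm (minus m x) <= M * (eps / (1 + M)))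
    by (apply Rmult_le_compat_l; lra).
  replace eps with (eps / (1 + M) + M * (eps / (1 + M))) by (field; lra).
  lra.
Qed.

End MeanValues.

(** * Mild solutions *)

Definition mild {V : NormedModule R_AbsRing} (S : R -> V -> V) (f : R -> V)
  (U0 : V) (U : R -> V) : Prop :=
  forall t, 0 <= t -> exists I,
    is_RInt (fun s => S (t - s) (f s)) 0 t I /\ U t = plus (S t U0) I.

Section Mild.
Context {W : CompleteNormedModule R_AbsRing}.
Local Notation V := (CompleteNormedModule.NormedModule R_AbsRing W).
Context (S : R -> V -> V) (M : R)
  (HS : bounded_semigroup S M) (f : R -> V) (U0 : V) (U : R -> V)
  (HU : mild S f U0 U).

Lemma mild_initial : U 0 = U0.
Proof.
  destruct (HU 0 (Rle_refl 0)) as [I [HI ->]].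
  rewrite (is_RInt_inj (W := W) _ _ _ _ _ HI (is_RInt_point _ _)).
  rewrite (semigroup_zero S M HS). apply plus_zero_r.
Qed.

(** The solution restarted at time [a] is again given by the variation of constants
    formula: [S (t - a)] maps the integral up to [a] to the same integral with
    kernel [S (t - s)]. *)
Lemma mild_restart (a t : R) :
  0 <= a <= t -> exists J,
    is_RInt (fun s => S (t - s) (f s)) a t J /\ U t = plus (S (t - a) (U a)) J.
Proof.
  intros [Ha Hat].
  destruct (HU t) as [I [HI HUt]]; [lra|]. destruct (HU a Ha) as [Ia [HIa HUa]].
  destruct (ex_RInt_Chasles_2 (V := W) (fun s => S (t - s) (f s)) 0 a t) as [J HJ];
    [lra|now exists I|].
  exists J. split; [exact HJ|].
  assert (Hlin := semigroup_linear S M HS (t - a)).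
  assert (HIa' : is_RInt (fun s => S (t - s) (f s)) 0 a (S (t - a) Ia)).
  { assert (H := is_RInt_linear _ _ _ _ _ Hlin HIa).
    revert H. apply is_RInt_ext. intros s Hs. rewrite Rmax_right in Hs; [|lra].
    rewrite -(semigroup_add S M HS); try lra. f_equal. lra. }
  assert (HC := is_RInt_Chasles _ _ _ _ _ _ HIa' HJ).
  rewrite HUt HUa (is_RInt_inj (W := W) _ _ _ _ _ HI HC).
  rewrite (linear_plus _ Hlin) -(semigroup_add S M HS); try lra.
  replace (t - a + a) with t by lra. apply plus_assoc.
Qed.

Lemma mild_free (a t : R) :
  0 <= a <= t -> (forall s, a < s < t -> f s = zero) -> U t = S (t - a) (U a).
Proof.
  intros Hat Hf. destruct (mild_restart a t Hat) as [J [HJ ->]].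
  assert (HJ0 : is_RInt (fun _ => zero) a t J).
  { revert HJ. apply is_RInt_ext. intros s Hs.
    rewrite Rmin_left in Hs; [|lra]. rewrite Rmax_right in Hs; [|lra].
    rewrite (Hf s Hs). apply linear_zero, (semigroup_linear S M HS). }
  rewrite (is_RInt_inj (W := W) _ _ _ _ _ HJ0 (is_RInt_const a t zero)).
  rewrite scal_zero_r. apply plus_zero_r.
Qed.

Context (S_contraction : forall t x, 0 <= t -> norm (S t x) <= norm x).

Lemma mild_forced (a t K : R) :
  0 <= a <= t -> 0 <= K -> (forall s, a < s < t -> norm (f s) <= K) ->
  norm (U t) <= norm (S (t - a) (U a)) + (t - a) * K.
Proof.
  intros Hat HK Hf. destruct (mild_restart a t Hat) as [J [HJ ->]].
  eapply Rle_trans; [apply norm_triangle|]. apply Rplus_le_compat_l.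
  (* The bound on [f] holds in the open interval only; the values at the two
     endpoints do not affect the integral and are set to zero. *)
  set (g s := match Rlt_dec a s, Rlt_dec s t with
              | left _, left _ => S (t - s) (f s)
              | _, _ => zero
              end).
  apply (norm_RInt_le_const g a t); [lra| |].
  - intros s Hs. unfold g.
    destruct (Rlt_dec a s); [|rewrite norm_zero; exact HK].
    destruct (Rlt_dec s t); [|rewrite norm_zero; exact HK].
    eapply Rle_trans; [apply S_contraction; lra|]. apply Hf. lra.
  - revert HJ. apply is_RInt_ext. intros s Hs.
    rewrite Rmin_left in Hs; [|lra]. rewrite Rmax_right in Hs; [|lra].
    unfold g. destruct (Rlt_dec a s); [|lra]. destruct (Rlt_dec s t); [easy|lra].
Qed.

(** One period: no forcing on [(a, m)], delayed forcing of strength [b] on [(m, e)].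
    The restrictions on [tau] put the delayed argument in [[a, m]], where the
    norm is already known to be at most [norm (U a)]. *)
Lemma period_estimate (tau b c a m e : R) :
  0 <= a -> tau <= m - a -> a <= m <= e -> e - m <= tau -> 0 <= b ->
  (forall s, a < s < m -> f s = zero) ->
  (forall s, m < s < e -> norm (f s) <= b * norm (U (s - tau))) ->
  (forall x, norm (S (m - a) x) <= c * norm x) ->
  (forall s, a <= s <= m -> norm (U s) <= norm (U a)) /\
  (forall s, m <= s <= e -> norm (U s) <= (c + b * (e - m)) * norm (U a)).
Proof.
  intros Ha Htau [Ham Hme] Hem Hb Hfree Hforced Hc.
  assert (Hfirst : forall s, a <= s <= m -> norm (U s) <= norm (U a)).
  { intros s Hs. rewrite (mild_free a s); [|lra|].
    - apply S_contraction. lra.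
    - intros r Hr. apply Hfree. lra. }
  split; [exact Hfirst|]. intros s Hs.
  assert (Hbn : 0 <= b * norm (U a))
    by (apply Rmult_le_pos; [exact Hb|apply norm_ge_0]).
  eapply Rle_trans; [apply (mild_forced m s (b * norm (U a)))|].
  - lra.
  - exact Hbn.
  - intros r Hr. eapply Rle_trans; [apply Hforced; lra|].
    apply Rmult_le_compat_l; [exact Hb|]. apply Hfirst. lra.
  - assert (H1 : norm (S (s - m) (U m)) <= norm (U m)) by (apply S_contraction; lra).
    assert (H2 : norm (U m) <= c * norm (U a)).
    { rewrite (mild_free a m); [apply Hc|lra|exact Hfree]. }
    assert (H3 : (s - m) * (b * norm (U a)) <= (e - m) * (b * norm (U a)))
      by (apply Rmult_le_compat_r; lra).
    lra.
Qed.

End Mild.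

(** * Exponential rates *)

(** The right side is [c * exp b + (exp b - 1)], and [1 + b <= exp b]. *)
Lemma affine_le_exp (b c : R) : 0 <= c -> 0 <= b ->
  c + b <= exp b * (c + 1 - exp (- b)).
Proof.
  intros Hc Hb.
  assert (He : exp b * exp (- b) = 1) by (rewrite -exp_plus Rplus_opp_r; apply exp_0).
  assert (H1 : 1 + b <= exp b) by apply exp_ineq1_le.
  assert (H2 : 0 <= c * (exp b - 1)) by (apply Rmult_le_pos; lra).
  lra.
Qed.

(** If [n] is the number of complete periods before [s], then [n > s / P - 1]; the
    incomplete period costs the factor [/ d]. *)
Lemma exponential_of_geometric (u : R -> R) (P d : R) :
  0 < P -> 0 < d < 1 -> 0 <= u 0 ->
  (forall n s, INR n * P <= s <= INR (n + 1) * P -> u s <= u (INR n * P)) ->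
  (forall n, u (INR (n + 1) * P) <= d * u (INR n * P)) ->
  forall s, 0 <= s -> u s <= / d * exp (- (- ln d / P) * s) * u 0.
Proof.
  intros HP Hd Hu0 Hper Hgeo s Hs.
  assert (Hpow : forall n, u (INR n * P) <= d ^ n * u 0).
  { induction n as [|n IH].
    - simpl. rewrite Rmult_0_l. lra.
    - replace (Datatypes.S n) with (n + 1)%nat by lia.
      eapply Rle_trans; [apply Hgeo|].
      apply Rle_trans with (d * (d ^ n * u 0)).
      + apply Rmult_le_compat_l; lra.
      + right. rewrite pow_add. ring. }
  destruct (nfloor_ex (s / P)) as [n [Hn Hn']].
  { apply Rdiv_le_0_compat; lra. }
  assert (Hs' : s = s / P * P) by (field; lra).
  eapply Rle_trans; [apply (Hper n)|].
  { rewrite plus_INR Hs'. simpl INR.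
    split; apply Rmult_le_compat_r; lra. }
  eapply Rle_trans; [apply Hpow|]. apply Rmult_le_compat_r; [exact Hu0|].
  assert (Hln : ln d < 0) by (rewrite -ln_1; apply ln_increasing; lra).
  rewrite -(Rpower_pow n d); [|lra]. rewrite /Rpower.
  rewrite -{2}(exp_ln d); [|lra]. rewrite -exp_Ropp -exp_plus.
  assert (Hexp : INR n * ln d <= - ln d + - (- ln d / P) * s).
  { replace (- ln d + - (- ln d / P) * s) with ((s / P - 1) * ln d) by (field; lra).
    rewrite !(Rmult_comm _ (ln d)). apply Rmult_le_compat_neg_l; lra. }
  destruct Hexp as [Hexp| ->]; [left; now apply exp_increasing|lra].
Qed.

(** * The Hilbert space as a real normed space *)

(** Boundedness makes the supremum finite, and homogeneity extends the bound from the
    unit ball to all vectors.  A vector of norm 0 cannot be normalised, but its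
    image is 0 by boundedness. *)
Lemma op_norm_spec {k : scalar_field} {H : HilbertSpace k} (T : bounded_operator H) :
  0 <= op_norm T /\ forall x : H, norm (T x) <= op_norm T * norm x.
Proof.
  assert (HT := bounded_operator_linear H T).
  destruct (linear_norm _ HT) as [K [HK Hbound]].
  assert (Hzero := linear_zero _ HT).
  unfold op_norm.
  set (E := fun r => exists x : H, norm x <= 1 /\ r = norm (T x)).
  destruct (Lub_Rbar_correct E) as [Hub Hlub].
  assert (H0 : Rbar_le 0 (Lub_Rbar E)).
  { apply Hub. exists zero. rewrite Hzero !norm_zero. split; lra. }
  assert (HK' : Rbar_le (Lub_Rbar E) K).
  { apply Hlub. intros r [x [Hx ->]]. simpl.
    eapply Rle_trans; [apply Hbound|].
    replace K with (K * 1) at 2 by ring. apply Rmult_le_compat_l; lra. }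
  destruct (Lub_Rbar E) as [l| |]; try easy. simpl in *.
  split; [exact H0|]. intros x.
  destruct (Rle_lt_or_eq_dec 0 (norm x) (norm_ge_0 x)) as [Hx|Hx].
  - set (V := realify H).
    assert (Hr : forall (a : R) (y : H), 0 < a ->
      norm (scal (of_real k a) y) = a * norm y)
      by (exact (norm_scal_pos (V := V))).
    assert (Hi : 0 < / norm x) by now apply Rinv_0_lt_compat.
    assert (Hle := Hub (norm (T (scal (of_real k (/ norm x)) x)))).
    rewrite (linear_scal _ HT) !Hr in Hle; try exact Hi.
    apply Rmult_le_reg_l with (/ norm x); [exact Hi|].
    replace (/ norm x * (l * norm x)) with l by (field; lra).
    apply Hle. exists (scal (of_real k (/ norm x)) x).
    rewrite (linear_scal _ HT) !Hr; try exact Hi. split; [|reflexivity].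
    right. field. lra.
  - specialize (Hbound x). rewrite -Hx Rmult_0_r in Hbound.
    rewrite -Hx Rmult_0_r. exact Hbound.
Qed.

Lemma bounded_operator_real_linear {k : scalar_field} {H : HilbertSpace k}
  (T : bounded_operator H) :
  is_linear (U := realify H) (V := realify H) T.
Proof.
  destruct (bounded_operator_linear H T) as [Hp Hs Hb].
  split; [exact Hp| |exact Hb]. intros a x. exact (Hs (of_real k a) x).
Qed.

Lemma re_inner_real_inner_product {k : scalar_field} (H : HilbertSpace k) :
  real_inner_product (V := realify H) (fun x y => re k (inner x y)).
Proof.
  split.
  - intros x y z.
    change (re k (inner (plus (x : H) y) z) = re k (inner x z) + re k (inner y z)).
    rewrite inner_plus. now destruct k.
  - intros a x z.
    change (re k (inner (scal (of_real k a) (x : H)) z) = a * re k (inner x z)).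
    rewrite inner_scal. destruct k; [reflexivity|].
    simpl. unfold mult. simpl. unfold Cmult. simpl. ring.
  - intros x y. rewrite (inner_conj k H y x). now destruct k.
  - intros x. rewrite inner_norm. now destruct k.
Qed.

(** * Exponential stability *)

Theorem theorem4p2
  (k : scalar_field) (H : HilbertSpace k)
  (A : linear_operator H) (S : R -> bounded_operator H)
  (M mu tau : R)
  (t : nat -> R)
  (Bn : nat -> bounded_operator H) (B : R -> bounded_operator H)
  (T0 Ttilde d : R)
  (* the standing assumptions *)
  (A_dissipative : dissipative A)
  (S_semigroup : C0_semigroup S)
  (A_generates : generates A S)
  (M_pos : 0 < M) (mu_pos : 0 < mu)
  (S_decay : forall s : R, 0 <= s -> op_norm (S s) <= M * exp (- mu * s))
  (tau_pos : 0 < tau)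
  (t_0 : t 0%nat = 0)
  (t_increasing : forall n : nat, t n < t (n + 1)%nat)
  (B_even : forall (n : nat) (s : R),
    t (2 * n)%nat <= s < t (2 * n + 1)%nat -> forall x : H, B s x = zero)
  (B_odd : forall (n : nat) (s : R),
    t (2 * n + 1)%nat <= s < t (2 * n + 2)%nat ->
    forall x : H, B s x = Bn (2 * n + 1)%nat x)
  (* the assumptions on the lengths of the intervals *)
  (T_even : forall n : nat, t (2 * n + 1)%nat - t (2 * n)%nat = T0)
  (T0_ge_tau : tau <= T0)
  (T0_gt_Tstar : / mu * ln M < T0)
  (T_odd : forall n : nat, t (2 * n + 2)%nat - t (2 * n + 1)%nat = Ttilde)
  (Ttilde_le_tau : Ttilde <= tau)
  (* the smallness assumption *)
  (d_sup : is_lub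
    (EUn (fun n : nat =>
       exp (op_norm (Bn (2 * n + 1)%nat) * Ttilde) *
       (M * exp (- mu * T0) + 1 - exp (- (op_norm (Bn (2 * n + 1)%nat) * Ttilde)))))
    d)
  (d_lt_1 : d < 1) :
  exists C alpha : R, 0 < C /\ 0 < alpha /\
    forall (U0 : H) (U : R -> H),
      mild_solution S B tau U0 U ->
      forall s : R, 0 < s -> norm (U s) <= C * exp (- alpha * s) * norm U0.
Proof.
  set (V := realify H).
  set (c := M * exp (- mu * T0)) in *.
  assert (Hc : 0 < c) by (apply Rmult_lt_0_compat; [exact M_pos|apply exp_pos]).
  assert (HTt : 0 < Ttilde).
  { assert (E := t_increasing 1%nat). assert (E' := T_odd 0%nat). simpl in *. lra. }
  set (P := T0 + Ttilde). assert (HP : 0 < P) by (unfold P; lra).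
  assert (Hdecay : forall s (x : H), 0 <= s ->
    norm (S s x) <= M * exp (- mu * s) * norm x).
  { intros s x Hs. eapply Rle_trans; [apply op_norm_spec|].
    apply Rmult_le_compat_r; [apply norm_ge_0|auto]. }
  assert (HS : bounded_semigroup (V := V) (fun s => S s) M).
  { destruct S_semigroup as [S_zero [S_add S_cont]].
    split; auto.
    - intros s. apply bounded_operator_real_linear.
    - intros s x Hs. eapply Rle_trans; [apply (Hdecay s x Hs)|].
      apply Rmult_le_compat_r; [apply (norm_ge_0 (V := V))|].
      rewrite -{2}(Rmult_1_r M). apply Rmult_le_compat_l; [lra|].
      rewrite -exp_0. assert (E : - mu * s <= 0).
      { assert (0 <= mu * s) by (apply Rmult_le_pos; lra). lra. }
      destruct E as [E| ->]; [left; now apply exp_increasing|lra]. }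
  assert (Hcontr : forall s (x : V), 0 <= s -> norm (S s x) <= norm x).
  { apply (dissipative_contraction (W := V) (fun s => S s) M HS _
      (re_inner_real_inner_product H)).
    intros x y Hxy. destruct (proj2 (A_generates x y) Hxy) as [Hx <-].
    now apply A_dissipative. }
  assert (Hlen : forall n, t (2 * n)%nat = INR n * P).
  { induction n as [|n IH]; [simpl; rewrite t_0; ring|].
    rewrite S_INR. replace (2 * Datatypes.S n)%nat with (2 * n + 2)%nat by lia.
    assert (E1 := T_even n). assert (E2 := T_odd n). unfold P in *. lra. }
  assert (Hd : forall n, c + op_norm (Bn (2 * n + 1)%nat) * Ttilde <= d).
  { intros n. eapply Rle_trans; [apply affine_le_exp|].
    - lra.
    - apply Rmult_le_pos; [apply op_norm_spec|lra].
    - apply (proj1 d_sup). now exists n. }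
  assert (Hd0 : 0 < d).
  { assert (E := Hd 0%nat). assert (0 <= op_norm (Bn (2 * 0 + 1)%nat) * Ttilde).
    { apply Rmult_le_pos; [apply op_norm_spec|lra]. }
    lra. }
  exists (/ d), (- ln d / P). split; [now apply Rinv_0_lt_compat|]. split.
  { assert (ln d < 0) by (rewrite -ln_1; apply ln_increasing; lra).
    apply Rdiv_lt_0_compat; lra. }
  intros U0 U [_ HU] s Hs.
  assert (Hmild : mild (V := V) (fun s => S s) (fun s => B s (U (s - tau))) U0 U)
    by exact HU.
  assert (Hper : forall n,
    (forall r, INR n * P <= r <= INR (n + 1) * P ->
      norm (U r) <= norm (U (INR n * P))) /\
    norm (U (INR (n + 1) * P)) <= d * norm (U (INR n * P))).
  { intros n. rewrite -!Hlen. replace (2 * (n + 1))%nat with (2 * n + 2)%nat by lia.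
    assert (E1 := T_even n). assert (E2 := T_odd n).
    assert (E0 : 0 <= t (2 * n)%nat).
    { rewrite Hlen. apply Rmult_le_pos; [apply pos_INR|lra]. }
    set (b := op_norm (Bn (2 * n + 1)%nat)).
    assert (Hdn := Hd n). fold b in Hdn.
    destruct (period_estimate (W := V) (fun s => S s) M HS
      (fun s => B s (U (s - tau))) U0 U Hmild Hcontr tau b c
      (t (2 * n)%nat) (t (2 * n + 1)%nat) (t (2 * n + 2)%nat)) as [Hfirst Hsecond];
      try lra.
    - apply op_norm_spec.
    - intros r Hr. apply (B_even n). lra.
    - intros r Hr. rewrite (B_odd n); [|lra]. apply op_norm_spec.
    - intros x. rewrite E1. apply Hdecay. lra.
    - rewrite E2 in Hsecond. change (@norm _ V) with (@norm _ H) in *.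
      assert (Hq : forall r, t (2 * n + 1)%nat <= r <= t (2 * n + 2)%nat ->
        norm (U r) <= d * norm (U (t (2 * n)%nat))).
      { intros r Hr. eapply Rle_trans; [apply Hsecond; exact Hr|].
        apply Rmult_le_compat_r; [apply norm_ge_0|exact Hdn]. }
      split; [|apply Hq; lra].
      intros r Hr. destruct (Rle_dec r (t (2 * n + 1)%nat)); [apply Hfirst; lra|].
      eapply Rle_trans; [apply Hq; lra|].
      rewrite -{2}(Rmult_1_l (norm _)). apply Rmult_le_compat_r; [apply norm_ge_0|lra]. }
  rewrite -(mild_initial (W := V) _ _ HS _ _ _ Hmild).
  apply (exponential_of_geometric (fun s => norm (U s))); try lra.
  - apply norm_ge_0.
  - intros n. apply Hper.
  - intros n. apply Hper.
Qed.
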